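(* Let $H=(V,E)$ be a connected hypergraph with $|V|\ge2$, let $\Omega=\Omega(H)$ be its multi-tree family and $\Gamma=\Gamma(H)$ its hypertree family. If $H$ is partition-connected, then $\operatorname{Mod}_2(\widehat\Omega)$ and $\operatorname{Mod}_2(\widehat\Gamma)$ have the same optimal density.
   Context: A hypergraph $H=(V,E)$ has a finite nonempty vertex set $V$ and a finite collection $E$ of subsets of $V$ (hyperedges), where repetitions are allowed (parallel hyperedges are distinct elements of $E$) and every hyperedge has at least two vertices. $H$ is connected if for every nonempty proper subset $X\subset V$ some hyperedge intersects both $X$ and $V\setminus X$. For a partition $\mathscr P$ of $V$ into nonempty parts, $|\mathscr P|$ is the number of parts and $\delta(\mathscr P)$ is the set of hyperedges intersecting at least two parts. $H$ is partition-connected if $|\delta(\mathscr P)|\ge|\mathscr P|-1$ for every partition $\mathscr P$ of $V$. A set (or multiset) $F$ of hyperedges is a hyperforest if for every nonempty $X\subseteq V$ at most $|X|-1$ members of $F$ (counted with multiplicity) are contained in $X$; a hypertree is a hyperforest with $|F|=|V|-1$. The hypertree family $\Gamma(H)$ is the family of all hypertrees $F\subseteq E$, each identified with its indicator vector in $\mathbb{R}^E_{\ge 0}$. For a multiset $A$ from $E$, $H[A]$ is the hypergraph with vertex set $\bigcup_{e\in A}e$ and hyperedges the members of $A$ (copies being parallel hyperedges), and $x^A\in\mathbb{R}^E_{\ge0}$ has $x^A(e)$ equal to the multiplicity of $e$ in $A$. The multi-tree family $\Omega(H)$ is the set of all $x^A$ such that $H[A]$ is a hypertree with vertex set $V$.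 For a family $\Gamma\subset\mathbb{R}^E_{\ge0}$, $\operatorname{Adm}(\Gamma)=\{\rho\in\mathbb{R}^E_{\ge0}:\gamma^T\rho\ge1\ \forall\gamma\in\Gamma\}$; the Fulkerson blocker family $\widehat\Gamma$ is the set of extreme points of $\operatorname{Adm}(\Gamma)$; $\operatorname{Mod}_2(\Gamma)=\inf_{\rho\in\operatorname{Adm}(\Gamma)}\sum_{e\in E}\rho(e)^2$, and its optimal density is the unique minimizer. *)

(* Defs.v *)
From HB Require Import structures.
From mathcomp Require Import all_boot all_order all_algebra.

Set Implicit Arguments.
Unset Strict Implicit.
Unset Printing Implicit Defensive.

Import Order.TTheory GRing.Theory Num.Theory.

(* Hyperedges are indexed by the finite type [edge], and [ends] need not be
   injective: this is how parallel hyperedges are represented. *)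
Record hypergraph := Hypergraph {
  vertex : finType;
  edge : finType;
  ends : edge -> {set vertex};
  vertex_gt0 : 0 < #|vertex|;
  ends_gt1 : forall e, 1 < #|ends e|
}.

Section Hypergraphs.
Variable H : hypergraph.

Local Notation V := (vertex H).
Local Notation E := (edge H).

Definition hypergraph_connected : Prop :=
  forall X : {set V}, X != set0 -> X \proper [set: V] ->
  exists e : E, (ends e :&: X != set0) /\
                (ends e :&: ~: X != set0).

Definition cut (P : {set {set V}}) : {set E} :=
  [set e : E | 1 < #|[set B in P | ends e :&: B != set0]|].

Definition partition_connected : Prop :=
  forall P : {set {set V}}, partition P [set: V] -> #|P| - 1 <= #|cut P|.

(* A multiset of hyperedges is given by its multiplicity function. *)
Definition edge_multiset := {ffun E -> nat}.

Definition multiset_of (F : {set E}) : edge_multiset :=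
  [ffun e => nat_of_bool (e \in F)].

(* The vertex set of H[A]. *)
Definition covered (A : edge_multiset) : {set V} :=
  \bigcup_(e | 0 < A e) ends e.

(* [W] is the vertex set of the hypergraph in which [A] is considered: the
   whole of [V] for subsets of E, and [covered A] for H[A]. *)
Definition is_hyperforest (W : {set V}) (A : edge_multiset) : Prop :=
  forall X : {set V}, X != set0 -> X \subset W ->
  \sum_(e | ends e \subset X) A e <= #|X| - 1.

Definition is_hypertree (W : {set V}) (A : edge_multiset) : Prop :=
  is_hyperforest W A /\ \sum_e A e = #|W| - 1.

End Hypergraphs.

From mathcomp Require Import boolp classical_sets reals.

Local Open Scope classical_set_scope.
Local Open Scope ring_scope.

Section Families.
Variables (R : realType) (H : hypergraph).

Definition multiplicity_vector (A : edge_multiset H) : {ffun edge H -> R} :=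
  [ffun e => (A e)%:R].

Definition hypertree_family : set {ffun edge H -> R} :=
  [set multiplicity_vector (multiset_of F) |
    F in [set F : {set edge H} |
            is_hypertree [set: vertex H]%SET (multiset_of F)]].

Definition multitree_family : set {ffun edge H -> R} :=
  [set multiplicity_vector A |
    A in [set A : edge_multiset H |
            covered A = [set: vertex H]%SET /\ is_hypertree (covered A) A]].

End Families.

Section Modulus.
Variables (R : realType) (E : finType).

Definition extreme_points (K : set {ffun E -> R}) : set {ffun E -> R} :=
  [set x | K x /\ forall (y z : {ffun E -> R}) (t : R),
     K y -> K z -> 0 < t < 1 ->
     x = [ffun e => t * y e + (1 - t) * z e] -> y = z].

Definition Adm (G : set {ffun E -> R}) : set {ffun E -> R} :=
  [set rho | (forall e, 0 <= rho e) /\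
             forall gamma, G gamma -> 1 <= \sum_e gamma e * rho e].

Definition Fulkerson_blocker (G : set {ffun E -> R}) : set {ffun E -> R} :=
  extreme_points (Adm G).

Definition energy2 (rho : {ffun E -> R}) : R := \sum_e rho e ^+ 2.

Definition Mod2 (G : set {ffun E -> R}) : R := inf [set energy2 rho | rho in Adm G].

Definition optimal_density (G : set {ffun E -> R}) (rho : {ffun E -> R}) : Prop :=
  [set r | Adm G r /\ energy2 r = Mod2 G] = [set rho].

End Modulus.

(* Main.v *)
(* Let x be the point of least norm of the convex hull of the hypertrees. Every
   hypertree in the support of x is of minimum x-weight, so by exchange it meets
   each level set U_c = {x <= c} in a maximal hyperforest of U_c. Uncrossing tight
   sets attaches to such a maximal hyperforest a partition P of V whose crossing
   hyperedges in U_c belong to every maximal hyperforest of U_c. If c < 1, each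
   hyperedge of U_c is avoided by some hypertree of the support; hence nothing in
   U_c crosses P, and the rank |V| - |P| of U_c bounds multi-hyperforests too. By
   Abel summation over the level sets (x <= 1), no multi-tree w is x-lighter than a
   hypertree of the support: <x, w> >= |x|^2. Therefore x / |x|^2 is admissible for
   both families, so that <x, y> >= |x|^2 for each y admissible for either
   blocker, and x is the optimal density of both. *)
Require Import Defs.
From mathcomp Require Import all_boot all_order all_algebra zify ring lra.

Set Implicit Arguments.
Unset Strict Implicit.
Unset Printing Implicit Defensive.

(** * Hyperforests and tight sets *)

Section Hyperforests.
Variable H : hypergraph.

Local Notation V := (vertex H).
Local Notation E := (edge H).

Implicit Types (F U : {set E}) (X Y B : {set V}) (P : {set {set V}}).

Definition induced F X : {set E} := [set e in F | ends e \subset X].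

Definition hyperforest F : bool :=
  [forall X : {set V}, (X != set0) ==> (#|induced F X| < #|X|)].

Definition hypertree F : bool := hyperforest F && (#|F|.+1 == #|V|).

Definition tight F X : bool := #|induced F X|.+1 == #|X|.

(** For a partition [P] of the vertices this is [U :&: cut P]; phrasing it by containment makes it
    the complement in [U] of the sets [induced U B]. *)
Definition crossing U P : {set E} :=
  [set e in U | ~~ [exists B in P, ends e \subset B]].

Definition maximal_hyperforest U F : bool :=
  [&& F \subset U, hyperforest F & [forall e in U :\: F, ~~ hyperforest (e |: F)]].

Lemma ends_neq0 (e : E) : ends e != set0.
Proof. by rewrite -card_gt0 (leq_trans _ (ends_gt1 e)). Qed.

Lemma induced_setT F : induced F [set: V] = F.
Proof. by apply/setP=> e; rewrite inE subsetT andbT. Qed.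

Lemma inducedS F F' X : F \subset F' -> induced F X \subset induced F' X.
Proof. by move=> /subsetP sF; apply/subsetP=> e; rewrite !inE => /andP[/sF-> ->]. Qed.

Lemma hyperforestP F :
  reflect (forall X, X != set0 -> #|induced F X| < #|X|) (hyperforest F).
Proof. by apply: (iffP forallP) => h X; [apply/implyP | apply/implyP/h]. Qed.

Lemma hyperforestS F F' : F \subset F' -> hyperforest F' -> hyperforest F.
Proof.
move=> sF /hyperforestP h; apply/hyperforestP=> X /h.
exact: leq_ltn_trans (subset_leq_card (inducedS X sF)).
Qed.

Lemma tight_neq0 F X : tight F X -> X != set0.
Proof. by move=> /eqP h; rewrite -card_gt0 -h. Qed.

(** No hyperedge fits in a singleton. Hence every vertex lies in some tight set. *)
Lemma tight1 F v : tight F [set v].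
Proof.
rewrite /tight cards1 eqSS cards_eq0; apply/eqP/setP=> e; rewrite !inE.
apply/negP=> /andP[_ /subset_leq_card]; rewrite cards1.
by have := ends_gt1 e; lia.
Qed.

(** Uncrossing: [#|induced F X|] is supermodular in [X] and [#|X|] is modular, so two zero deficits
    leave no room for a positive one at the union or the intersection. *)
Lemma tightUI F X Y : hyperforest F -> tight F X -> tight F Y ->
  X :&: Y != set0 -> tight F (X :|: Y) && tight F (X :&: Y).
Proof.
move=> /hyperforestP hF /eqP tX /eqP tY nz.
have nzU : X :|: Y != set0.
  by apply: contraNneq nz => /eqP; rewrite setU_eq0 => /andP[/eqP-> _]; rewrite set0I.
have hI := hF _ nz; have hU := hF _ nzU.
have IE : induced F (X :&: Y) = induced F X :&: induced F Y.
  by apply/setP=> e; rewrite !inE subsetI; case: (e \in F).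
have sU : induced F X :|: induced F Y \subset induced F (X :|: Y).
  apply/subsetP=> e; rewrite !inE => /orP[] /andP[-> s] /=;
  by apply: subset_trans s _; rewrite ?subsetUl ?subsetUr.
have := subset_leq_card sU.
have := cardsUI (induced F X) (induced F Y); have := cardsUI X Y.
rewrite /tight IE in hI hU *.
by move=> *; apply/andP; split; apply/eqP; lia.
Qed.

(** A set violated by [e |: F] gains only [e], so it contains [e] and had no room left in [F]. *)
Lemma not_hyperforest_tight F e : hyperforest F -> ~~ hyperforest (e |: F) ->
  exists2 X, tight F X & ends e \subset X.
Proof.
move=> /hyperforestP hF /forallPn[X]; rewrite negb_imply -leqNgt => /andP[nz le].
have lt := hF _ nz; exists X; last first.
  apply/negP => /negP ne.
  suff E0 : induced (e |: F) X = induced F X by rewrite E0 in le; lia.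
  apply/setP=> f; rewrite !inE; case: (f =P e) => [->|//].
  by rewrite (negPf ne) !andbF.
have : induced (e |: F) X \subset e |: induced F X.
  by apply/subsetP=> f; rewrite !inE => /andP[/orP[->//|->] ->]; rewrite orbT.
move=> /subset_leq_card; rewrite cardsU1 /tight => leU; apply/eqP.
by move: leU; case: (_ \notin _); lia.
Qed.

Lemma tight_hyperforest_add F F' X e : F \subset F' -> e \in F' -> e \notin F ->
  tight F X -> ends e \subset X -> ~~ hyperforest F'.
Proof.
move=> sF eF' eF /eqP tX eX; apply/negP=> /hyperforestP/(_ X).
have nz : X != set0 by rewrite -card_gt0 -tX.
move=> /(_ nz); rewrite -tX ltnS leqNgt => /negP; apply.
apply: proper_card; apply/properP; split; first exact: inducedS.
by exists e; rewrite !inE ?eX ?eF' // (negPf eF).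
Qed.

(** * The partition of the vertices into maximal tight sets *)

Definition hull F v : {set V} := \bigcup_(X | tight F X && (v \in X)) X.

(* Tight sets through v are closed under union, by uncrossing. *)
Lemma hull_tight F v : hyperforest F -> tight F (hull F v) && (v \in hull F v).
Proof.
move=> hF; have vh : v \in hull F v.
  by apply/bigcupP; exists [set v]; rewrite ?tight1 inE eqxx.
(* The alternative [set0] covers the initial value of the iterated union, which is not tight. *)
rewrite vh andbT; suff : (hull F v == set0) || tight F (hull F v) && (v \in hull F v).
  by case/orP=> [/eqP h|/andP[]//]; rewrite h inE in vh.
rewrite /hull; elim/big_rec: _ => [|X Y /andP[tX vX]]; first by rewrite eqxx.
move=> /orP[/eqP->|/andP[tY vY]]; apply/orP; right; first by rewrite setU0 tX.
have nz : X :&: Y != set0 by apply/set0Pn; exists v; rewrite inE vX.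
by have /andP[-> _] := tightUI hF tX tY nz; rewrite inE vX.
Qed.

Lemma sub_hull F v X : tight F X -> v \in X -> X \subset hull F v.
Proof. by move=> tX vX; apply: bigcup_sup; rewrite tX. Qed.

Definition hulls F : {set {set V}} := [set hull F v | v in [set: V]].

(** If two hulls meet, their union is tight and passes through both base vertices, so each hull
    equals it. *)
Lemma hulls_partition F : hyperforest F -> partition (hulls F) [set: V].
Proof.
move=> hF; apply/and3P; split.
- apply/eqP/setP=> v; rewrite inE; apply/bigcupP; exists (hull F v).
    exact: imset_f.
  by case/andP: (hull_tight v hF).
- apply/trivIsetP=> _ _ /imsetP[u _ ->] /imsetP[v _ ->]; apply: contraR.
  rewrite -setI_eq0 => nz.
  have /andP[tu mu] := hull_tight u hF; have /andP[tv mv] := hull_tight v hF.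
  have /andP[tU _] := tightUI hF tu tv nz.
  rewrite eqEsubset; apply/andP; split.
    by apply: subset_trans (subsetUl _ _) (sub_hull tU _); rewrite inE mv orbT.
  by apply: subset_trans (subsetUr _ _) (sub_hull tU _); rewrite inE mu.
apply/imsetP=> -[v _ h]; have /andP[/tight_neq0] := hull_tight v hF.
by rewrite -h eqxx.
Qed.

(** * Counting hyperedges along a partition *)

Lemma big_partition_edges (A : E -> nat) U P : partition P [set: V] ->
  \sum_(e in U) A e =
    \sum_(e in crossing U P) A e + \sum_(B in P) \sum_(e in induced U B) A e.
Proof.
move=> partP; rewrite (bigID (mem (crossing U P))) /=; congr (_ + _).
  by apply: eq_bigl => e; rewrite !inE; case: (e \in U).
transitivity (\sum_(B in P) \sum_(e in U | ends e \subset B) A e); last first.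
  by apply: eq_bigr => B _; apply: eq_bigl => e; rewrite !inE.
rewrite (exchange_big_dep (mem U)) //=; last by move=> B e _ /andP[].
rewrite [RHS](bigID (fun e => [exists B in P, ends e \subset B])) /=.
rewrite [X in _ = _ + X]big1 ?addn0; last first.
  move=> e /andP[_ nex]; rewrite big_pred0 // => B; apply/negP=> /andP[BP /andP[_ s]].
  by case/negP: nex; apply/existsP; exists B; rewrite BP.
apply: eq_big => e; first by rewrite !inE; case: (e \in U); rewrite ?negbK.
rewrite !inE => /andP[eU]; rewrite eU negbK => /existsP[B /andP[BP eB]].
rewrite (big_pred1 B) // => C /=; apply/andP/eqP => [[CP eC]|->//].
have /and3P[_ /trivIsetP tI _] := partP.
apply/eqP/negPn/negP => nCB; have := tI _ _ CP BP nCB.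
rewrite -setI_eq0; apply/negP; have /set0Pn[v ve] := ends_neq0 e.
by apply/set0Pn; exists v; rewrite inE (subsetP eC) ?(subsetP eB).
Qed.

Lemma card_partition_pred P : partition P [set: V] ->
  \sum_(B in P) (#|B| - 1) + #|P| = #|V|.
Proof.
move=> partP; rewrite -[#|V|]cardsT (card_partition partP) -sum1_card -big_split /=.
apply: eq_bigr => B BP; rewrite subnK // card_gt0.
by case/and3P: partP => _ _; apply: contraNneq => <-.
Qed.

Lemma partition_part_neq0 P B : partition P [set: V] -> B \in P -> B != set0.
Proof. by case/and3P => _ _ h BP; apply: contraNneq h => <-. Qed.

(** Each part [B] holds at most [#|B| - 1] hyperedges, and these bounds add up to [#|V| - #|P|]. The
    additive form avoids truncated subtraction. *)
Lemma multiforest_bound (A : edge_multiset H) U P : partition P [set: V] ->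
  is_hyperforest [set: V] A ->
  \sum_(e in U) A e + #|P| <= \sum_(e in crossing U P) A e + #|V|.
Proof.
move=> partP hA; rewrite (big_partition_edges A U partP) -addnA leq_add2l.
rewrite -(card_partition_pred partP) leq_add2r; apply: leq_sum => B BP.
apply: leq_trans (hA B (partition_part_neq0 partP BP) (subsetT _)).
rewrite [leqRHS](bigID (mem U)) /= -[leqLHS]addn0; apply: leq_add => //.
by under eq_bigl do rewrite !inE andbC.
Qed.

Lemma sum_multiset_of F U : \sum_(e in U) multiset_of F e = #|F :&: U|.
Proof.
rewrite -sum1_card big_mkcond [RHS]big_mkcond /=; apply: eq_bigr => e _.
by rewrite ffunE inE andbC; do 2!case: (_ \in _).
Qed.

Lemma is_hyperforestP F :
  reflect (is_hyperforest [set: V] (multiset_of F)) (hyperforest F).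
Proof.
have sumE X : \sum_(e | ends e \subset X) multiset_of F e = #|induced F X|.
  transitivity (\sum_(e in [set e | ends e \subset X]) multiset_of F e).
    by apply: eq_bigl => e; rewrite inE.
  by rewrite sum_multiset_of; apply: eq_card => e; rewrite !inE.
apply: (iffP (hyperforestP F)) => h X nz; last first.
  by have := h X nz (subsetT _); rewrite sumE leq_subRL ?card_gt0 // add1n.
by move=> _; rewrite sumE leq_subRL ?card_gt0 // add1n h.
Qed.

Lemma is_hypertreeP F :
  reflect (is_hypertree [set: V] (multiset_of F)) (hypertree F).
Proof.
have sumE : \sum_e multiset_of F e = #|F|.
  transitivity (\sum_(e in [set: E]) multiset_of F e).
    by apply: eq_bigl => e; rewrite inE.
  by rewrite sum_multiset_of setIT.
rewrite /is_hypertree sumE cardsT /hypertree.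
have V0 := vertex_gt0 H.
apply: (iffP andP) => -[/is_hyperforestP hF cF]; split=> //.
  by rewrite -(eqP cF) subn1.
by rewrite cF subn1 prednK.
Qed.

(** If [v] were missed, all [#|V| - 1] hyperedges would lie in the complement of [v], which has room
    for at most [#|V| - 2]. *)
Lemma hypertree_covered F : 1 < #|V| -> hypertree F ->
  covered (multiset_of F) = [set: V].
Proof.
move=> V1 /andP[/hyperforestP hF /eqP cF]; apply/setP=> v; rewrite [RHS]inE.
apply/negPn/negP => nv; have := hF (~: [set v]).
rewrite cardsC1 -card_gt0 cardsC1.
have -> : induced F (~: [set v]) = F.
  apply/setP=> e; rewrite inE andb_idr // => eF; apply/subsetP=> u ue; rewrite !inE.
  apply: contraNneq nv => <-; apply/bigcupP; exists e => //.
  by rewrite ffunE eF.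
by lia.
Qed.

(** * Maximal hyperforests, existence of hypertrees and exchange *)

Lemma maximal_crossing_sub U F : maximal_hyperforest U F ->
  crossing U (hulls F) \subset F.
Proof.
case/and3P=> sF hF /forall_inP mx; apply/subsetP=> e; rewrite inE => /andP[eU].
apply: contraR => eF.
have /(not_hyperforest_tight hF)[X tX eX] : ~~ hyperforest (e |: F).
  by apply: mx; rewrite inE eF.
have /set0Pn[v ve] := ends_neq0 e.
apply/existsP; exists (hull F v); rewrite imset_f ?inE //=.
exact: subset_trans eX (sub_hull tX (subsetP eX v ve)).
Qed.

(** The equality case of [multiforest_bound]: every part is tight, and all crossing hyperedges
    belong to [F]. *)
Lemma card_maximal_hyperforest U F : maximal_hyperforest U F ->
  #|F| + #|hulls F| = #|crossing U (hulls F)| + #|V|.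
Proof.
move=> mF; have sC := maximal_crossing_sub mF; case/and3P: mF => sF hF mx.
have partP := hulls_partition hF.
rewrite -sum1_card (big_partition_edges (fun=> 1) F partP) sum1_card -addnA.
congr (_ + _).
  congr #|pred_of_set _|; apply/setP=> e; rewrite !inE.
  case: (boolP (e \in F)) => [/(subsetP sF)->//|eF] /=.
  by apply/esym/negP => h; case/negP: eF; apply: (subsetP sC); rewrite inE.
rewrite -(card_partition_pred partP); congr (_ + _); apply: eq_bigr.
move=> _ /imsetP[v _ ->]; rewrite sum1_card.
by have /andP[/eqP<- _] := hull_tight v hF; rewrite subn1.
Qed.

Lemma hyperforest_bound F U P : partition P [set: V] -> hyperforest F ->
  F \subset U -> #|F| + #|P| <= #|F :&: crossing U P| + #|V|.
Proof.
move=> partP /is_hyperforestP hF sF.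
by have := multiforest_bound U partP hF; rewrite !sum_multiset_of (setIidPl sF).
Qed.

Lemma hyperforest_leq_maximal U F F' : maximal_hyperforest U F ->
  hyperforest F' -> F' \subset U -> #|F'| <= #|F|.
Proof.
move=> mF hF' sF'; have := card_maximal_hyperforest mF.
have /and3P[_ hF _] := mF.
have := hyperforest_bound (hulls_partition hF) hF' sF'.
have := subset_leq_card (subsetIr F' (crossing U (hulls F))).
by lia.
Qed.

(** Maximal hyperforests of [U] have equal size, so the bound that the hulls of [F] give for [F'] is
    attained, which forces [F'] to use every crossing hyperedge. *)
Lemma crossing_sub_maximal U F F' : maximal_hyperforest U F ->
  maximal_hyperforest U F' -> crossing U (hulls F) \subset F'.
Proof.
move=> mF mF'; have cF := card_maximal_hyperforest mF.
have /and3P[sF hF _] := mF; have /and3P[sF' hF' _] := mF'.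
have := hyperforest_leq_maximal mF' hF sF.
have := hyperforest_bound (hulls_partition hF) hF' sF'.
move=> h1 h2; apply/setIidPr/eqP.
by rewrite eqEcard subsetIr; lia.
Qed.

(** Only repeated crossing hyperedges could push a multi-hyperforest above [#|F|]. A crossing
    hyperedge lies in every maximal hyperforest, so avoidance leaves none. *)
Lemma multiforest_leq_maximal U F (A : edge_multiset H) :
  maximal_hyperforest U F ->
  (forall e, e \in U -> exists2 F', maximal_hyperforest U F' & e \notin F') ->
  is_hyperforest [set: V] A -> \sum_(e in U) A e <= #|F|.
Proof.
move=> mF avoid hA; have cF := card_maximal_hyperforest mF.
have /and3P[_ hF _] := mF.
have := multiforest_bound U (hulls_partition hF) hA.
suff C0 : crossing U (hulls F) = set0 by rewrite C0 big_set0 cards0 in cF *; lia.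
apply/eqP; rewrite -subset0; apply/subsetP=> e eC.
have [|F' mF'] := avoid e; first by move: eC; rewrite inE => /andP[].
by rewrite (subsetP (crossing_sub_maximal mF mF')).
Qed.

(** For a maximal hyperforest of the whole edge set, partition-connectedness applied to its hulls
    supplies at least [#|hulls F| - 1] crossing hyperedges, which brings its size up to
    [#|V| - 1]. *)
Lemma hypertree_exists : partition_connected H -> exists F, hypertree F.
Proof.
move=> pc; have hF0 : hyperforest set0.
  apply/hyperforestP=> X; rewrite -card_gt0.
  suff -> : induced set0 X = set0 by rewrite cards0.
  by apply/setP=> e; rewrite !inE.
have [F /maxsetP[hF mx] _] := maxset_exists hF0.
have mF : maximal_hyperforest [set: E] F.
  rewrite /maximal_hyperforest subsetT hF; apply/forall_inP => e.
  rewrite inE => /andP[eF _]; apply: contraNN eF => /mx /(_ (subsetUr _ _)) <-.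
  by rewrite setU11.
exists F; rewrite /hypertree hF /=.
have cF := card_maximal_hyperforest mF; have partP := hulls_partition hF.
have := pc _ partP.
have : cut (hulls F) \subset crossing [set: E] (hulls F).
  apply/subsetP=> e; rewrite !inE /= => c1; apply/negP=> /existsP[B /andP[BP eB]].
  have : [set C in hulls F | ends e :&: C != set0] \subset [set B].
    apply/subsetP=> C; rewrite !inE => /andP[CP nz]; apply/negPn/negP => nCB.
    have /and3P[_ /trivIsetP tI _] := partP.
    have := tI _ _ CP BP nCB; rewrite -setI_eq0; apply/negP.
    apply: contraNneq nz => d; rewrite -subset0 -d setIC; apply: setIS eB.
  by move=> /subset_leq_card; rewrite cards1 leqNgt c1.
move=> /subset_leq_card.
have := hyperforestP F hF [set: V]; rewrite induced_setT.
have V0 := vertex_gt0 H; rewrite -card_gt0 cardsT => /(_ V0).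
have : 0 < #|hulls F|.
  have /card_gt0P[v _] := V0.
  by apply/card_gt0P; exists (hull F v); apply: imset_f.
have [n nE] : {n | n = #|V|} by exists #|V|.
by move=> h1 h2 h3 h4; rewrite -nE in cF h2 *; apply/eqP; lia.
Qed.

(* The hyperedges inside the smallest tight set X spanning e form, with e, the
   unique circuit of e |: F. *)
Lemma hypertree_exchange F e U : hypertree F -> e \in U -> e \notin F ->
  hyperforest (e |: (F :&: U)) ->
  exists2 f, f \in F :\: U & hypertree (e |: (F :\ f)).
Proof.
move=> /andP[hF cF] eU eF hU.
pose C := [pred X : {set V} | tight F X && (ends e \subset X)].
have CT : C [set: V] by rewrite /= subsetT /tight induced_setT cardsT cF.
have [X /minsetP[/andP[tX eX] mX] _] := minset_exists CT.
have subX Y : tight F Y -> ends e \subset Y -> X \subset Y.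
  move=> tY eY; rewrite -(mX (X :&: Y)) ?subsetIr ?subsetIl //= subsetI eX eY andbT.
  suff /andP[_ ->//] : tight F (X :|: Y) && tight F (X :&: Y).
  apply: tightUI => //; have /set0Pn[v ve] := ends_neq0 e.
  by apply/set0Pn; exists v; rewrite inE (subsetP eX) ?(subsetP eY).
(* If all hyperedges of [F] inside [X] were in [U], then [X] would be tight for [F :&: U] and [e]
   could not be added. *)
have [f] : exists f, f \in induced F X :\: U.
  apply/set0Pn; apply: contraTneq hU => /eqP; rewrite setD_eq0 => sX.
  apply: (@tight_hyperforest_add (F :&: U) _ X e) => //.
  - exact: subsetUr.
  - exact: setU11.
  - by rewrite inE (negPf eF).
  suff -> : tight (F :&: U) X = tight F X by [].
  congr (#|pred_of_set _|.+1 == _); apply/setP=> f; have := subsetP sX f; rewrite !inE.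
  by case: (f \in F) => //= h; case: (ends f \subset X) h => [->//|]; rewrite ?andbF.
rewrite !inE => /andP[fU /andP[fF fX]]; exists f; first by rewrite inE fU.
rewrite /hypertree; apply/andP; split; last first.
  by rewrite cardsU1 !inE (negPf eF) andbF -(eqP cF) (cardsD1 f F) fF.
(* A set [Y] blocking the exchange is tight for [F :\ f], hence for [F] with the same induced
   hyperedges; but it contains [X], hence [f]. *)
apply/negPn/negP => nF.
have [Y tY eY] := not_hyperforest_tight (hyperforestS (subsetDl _ _) hF) nF.
have nz := tight_neq0 tY.
have sI := inducedS Y (subsetDl F [set f]).
have lt := hyperforestP F hF Y nz.
have E0 : induced (F :\ f) Y = induced F Y.
  by have /eqP cY := tY; apply/eqP; rewrite eqEcard sI -ltnS cY.
have tFY : tight F Y by rewrite /tight -E0.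
have : f \in induced F Y by rewrite inE fF (subset_trans fX (subX _ tFY eY)).
by rewrite -E0 !inE eqxx.
Qed.

End Hyperforests.

From mathcomp Require Import boolp classical_sets reals topology normedtype derive.

Import Order.TTheory GRing.Theory Num.Theory.
Import numFieldNormedType.Exports.

Local Open Scope classical_set_scope.
Local Open Scope ring_scope.

(** * The point of least norm of a convex hull *)

Section ConvexHull.
Variables (R : realType) (E : finType).
Implicit Types x y z d : {ffun E -> R}.

Definition dot x y : R := \sum_e x e * y e.

Lemma dotC x y : dot x y = dot y x.
Proof. by apply: eq_bigr => e _; rewrite mulrC. Qed.

Lemma energy2_dot x : energy2 x = dot x x.
Proof. by apply: eq_bigr => e _; rewrite expr2. Qed.

Lemma energy2_ge0 x : 0 <= energy2 x.
Proof. by apply: sumr_ge0 => e _; rewrite sqr_ge0. Qed.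

Lemma dot_comb (s t : R) y z x :
  dot [ffun e => s * y e + t * z e] x = s * dot y x + t * dot z x.
Proof.
by rewrite !mulr_sumr -big_split; apply: eq_bigr => e _ /=; rewrite ffunE; ring.
Qed.

Lemma energy2_comb (s t : R) y z :
  energy2 [ffun e => s * y e + t * z e] =
  s ^+ 2 * energy2 y + 2 * (s * t) * dot y z + t ^+ 2 * energy2 z.
Proof.
rewrite !mulr_sumr -!big_split; apply: eq_bigr => e _ /=; rewrite ffunE; ring.
Qed.

Definition combination n (p : 'I_n -> R) (v : 'I_n -> {ffun E -> R}) :
  {ffun E -> R} := [ffun e => \sum_i p i * v i e].

Lemma dot_combination n (p : 'I_n -> R) v x :
  dot (combination p v) x = \sum_i p i * dot (v i) x.
Proof.
transitivity (\sum_e \sum_i p i * (v i e * x e)).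
  apply: eq_bigr => e _; rewrite ffunE mulr_suml.
  by apply: eq_bigr => i _; rewrite mulrA.
by rewrite exchange_big; apply: eq_bigr => i _; rewrite mulr_sumr.
Qed.

Definition simplex n : set 'rV[R]_n :=
  [set p | (forall i, 0 <= p ord0 i) /\ \sum_i p ord0 i = 1].

Lemma sum_coord_continuous n (c : 'I_n -> R) :
  continuous (fun p : 'rV[R]_n => \sum_i p ord0 i * c i).
Proof.
apply: continuous_big => [|i _ p]; first exact: add_continuous.
by apply: continuousM; [exact: coord_continuous | exact: cst_continuous].
Qed.

Lemma simplex_compact n : compact (@simplex n).
Proof.
pose B := [set p : 'rV[R]_n | forall i, `[0, 1]%classic (p ord0 i)].
(* The factor 1 gives the sum the form required by [sum_coord_continuous]. *)
pose S := (fun p : 'rV[R]_n => \sum_i p ord0 i * 1) @^-1` [set y | y = 1].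
have -> : @simplex n = B `&` S.
  apply/seteqP; split=> p; rewrite /B /S /simplex /= => -[h0 h1]; split.
  - move=> i; rewrite in_itv /= h0 -h1 (bigD1 i) //= lerDl.
    by apply: sumr_ge0 => j _.
  - by under eq_bigr do rewrite mulr1.
  - by move=> i; have := h0 i; rewrite in_itv /= => /andP[].
  - by move: h1; under eq_bigr do rewrite mulr1.
apply: compact_closedI.
  by apply: (@rV_compact R n (fun=> `[0, 1]%classic)) => i; exact: segment_compact.
apply: preimage_closed; last exact: closed_eq.
by move=> p _; exact: (@sum_coord_continuous n (fun=> 1)).
Qed.

(** A minimizer exists because the simplex of weights is compact; the inequalities are its
    first-order conditions along the segments towards the [v i]. *)
Lemma min_norm_combination n (v : 'I_n -> {ffun E -> R}) : (0 < n)%N ->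
  exists p : 'I_n -> R, [/\ forall i, 0 <= p i, \sum_i p i = 1 &
    forall i, energy2 (combination p v) <= dot (combination p v) (v i)].
Proof.
move=> n0; pose comb (p : 'rV[R]_n) := combination (p ord0) v.
have simplex0 : @simplex n !=set0.
  exists (\row_i (i == Ordinal n0)%:R); split=> [i|]; rewrite ?mxE ?ler0n //.
  rewrite (bigD1 (Ordinal n0)) //= mxE eqxx big1 ?addr0 // => i /negPf ne.
  by rewrite mxE ne.
have cf : continuous (fun p => energy2 (comb p)).
  apply: continuous_big => [|e _ p]; first exact: add_continuous.
  have ce : continuous (fun p => comb p e).
    rewrite /comb /combination; under eq_fun do rewrite ffunE.
    exact: (@sum_coord_continuous n (fun i => v i e)).
  exact: (continuousM (ce p) (ce p)).
have [p] := EVT_min_rV simplex0 (@simplex_compact n) (continuous_subspaceT cf).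
rewrite inE => -[p0 p1] pmin; exists (p ord0); split=> // i.
set x := combination (p ord0) v.
have seg t : 0 <= t <= 1 ->
    energy2 x <= energy2 [ffun e => (1 - t) * x e + t * v i e].
  move=> t01; pose q : 'rV[R]_n := \row_j ((1 - t) * p ord0 j + t * (j == i)%:R).
  have qv (f : 'I_n -> R) :
      \sum_j q ord0 j * f j = (1 - t) * (\sum_j p ord0 j * f j) + t * f i.
    rewrite mulr_sumr; under eq_bigr do rewrite mxE mulrDl -mulrA.
    rewrite big_split /=; congr (_ + _).
    rewrite (bigD1 i) //= eqxx mulr1 big1 ?addr0 //.
    by move=> j /negPf ->; rewrite mulr0 mul0r.
  have -> : [ffun e => (1 - t) * x e + t * v i e] = comb q.
    by apply/ffunP=> e; rewrite !ffunE qv.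
  apply: pmin; rewrite inE; split=> [j|].
    rewrite mxE addr_ge0 // mulr_ge0 ?ler0n //; first by lra.
    by case/andP: t01.
  have := qv (fun=> 1); under eq_bigr do rewrite mulr1; move=> ->.
  by under eq_bigr do rewrite mulr1; rewrite p1; ring.
rewrite leNgt; apply/negP => lt.
(* On the segment the energy is [energy2 x + t * (t * D - 2 * a)]. The choice [t = a / (a + D)]
   gives [t * D <= a], hence a strict decrease, and is defined even when [D = 0]. *)
pose a := energy2 x - dot x (v i).
pose D := energy2 x - 2 * dot x (v i) + energy2 (v i).
have D0 : 0 <= D.
  rewrite (_ : D = energy2 [ffun e => 1 * x e + -1 * v i e]) ?energy2_ge0 //.
  by rewrite energy2_comb /D; ring.
have a0 : 0 < a by rewrite subr_gt0.
have aD : 0 < a + D by lra.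
have [tD ta] : a / (a + D) * D <= a /\ 0 <= a / (a + D) <= 1.
  split; first by rewrite mulrAC ler_pdivrMr // ler_wpM2l ?ltW //; lra.
  by rewrite divr_ge0 ?(ltW a0) ?(ltW aD) //= ler_pdivrMr // mul1r; lra.
have t0 : 0 < a / (a + D) by rewrite divr_gt0.
have := seg _ ta; rewrite energy2_comb.
move: (a / (a + D)) tD ta t0 => t tD ta t0.
have -> : (1 - t) ^+ 2 * energy2 x + 2 * ((1 - t) * t) * dot x (v i) +
    t ^+ 2 * energy2 (v i) = energy2 x + t * (t * D - 2 * a) by rewrite /D /a; ring.
by rewrite lerDl pmulr_rge0 //; lra.
Qed.

(** The gaps [dot x (v i) - energy2 x] are nonnegative with weighted mean zero, so those of positive
    weight vanish. *)
Lemma min_norm_support n (p : 'I_n -> R) v : (forall i, 0 <= p i) -> \sum_i p i = 1 ->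
  (forall i, energy2 (combination p v) <= dot (combination p v) (v i)) ->
  forall i, 0 < p i -> dot (combination p v) (v i) = energy2 (combination p v).
Proof.
set x := combination p v => p0 p1 h i pi.
have : \sum_i p i * (dot x (v i) - energy2 x) = 0.
  under eq_bigr do rewrite mulrBr dotC.
  rewrite sumrB -dot_combination -mulr_suml p1 mul1r -/x energy2_dot; exact: subrr.
move=> /psumr_eq0P/(_ i) h0; apply/eqP; rewrite -subr_eq0.
have : p i * (dot x (v i) - energy2 x) == 0.
  by apply/eqP/h0 => // j _; rewrite mulr_ge0 // subr_ge0.
by rewrite mulf_eq0 gt_eqF.
Qed.

End ConvexHull.

(** * Extreme points, blockers and optimal densities *)

Section Blocker.
Variables (R : realType) (E : finType).
Implicit Types x y z d s : {ffun E -> R}.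

(* The constraints defining [Adm (range g)]: [inl e] stands for the sign of the
   coordinate e, [inr k] for the inequality given by [g k]. *)
Definition normal n (g : 'I_n -> {ffun E -> R}) (i : E + 'I_n) d : R :=
  match i with inl e => d e | inr k => dot (g k) d end.

Definition slack n (g : 'I_n -> {ffun E -> R}) (i : E + 'I_n) s : R :=
  normal g i s - (if i is inr _ then 1 else 0).

Lemma normal_comb n (g : 'I_n -> {ffun E -> R}) i (a b : R) y z :
  normal g i [ffun e => a * y e + b * z e] = a * normal g i y + b * normal g i z.
Proof. by case: i => [e|k] /=; rewrite ?ffunE // dotC dot_comb !(dotC _ (g k)). Qed.

Lemma AdmP n (g : 'I_n -> {ffun E -> R}) s :
  Adm (range g) s <-> forall i, 0 <= slack g i s.
Proof.
split=> [[s0 h] [e|k]|h]; rewrite /slack /= ?subr0 ?subr_ge0 //.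
  by apply: h; exists k.
split=> [e|_ [k _ <-]]; first by have := h (inl e); rewrite /slack /= subr0.
by have := h (inr k); rewrite /slack /= subr_ge0.
Qed.

(* Move along a line on which the tight constraints stay tight until a new
   constraint becomes tight. *)
Lemma extreme_point_below n (g : 'I_n -> {ffun E -> R}) x s :
  (forall e, 0 <= x e) -> Adm (range g) s ->
  exists2 s', extreme_points (Adm (range g)) s' & dot s' x <= dot s x.
Proof.
move=> x0; have [m] := ubnP #|[set i | slack g i s != 0]%SET|.
elim: m s => // m IH s lem sK.
have [ext|/not_andP[//|]] := pselect (extreme_points (Adm (range g)) s).
  by exists s.
move=> /existsNP[y /existsNP[z /existsNP[t]]].
move=> /not_implyP[yK /not_implyP[zK /not_implyP[t01 /not_implyP[sE yz]]]].
(* The direction is [y - z] or its opposite, with the sign chosen so that [dot d x] does not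
   increase. A negative coordinate ensures that the ray meets a new constraint; when [dot d x < 0]
   it exists because [x] is nonnegative. *)
have [d [dx [e de] dtight]] : exists d, [/\ dot d x <= 0, exists e, d e < 0 &
    forall i, slack g i s = 0 -> normal g i d = 0].
  pose dd (c : R) := [ffun e => c * y e + - c * z e].
  have tight c i : slack g i s = 0 -> normal g i (dd c) = 0.
    have /AdmP/(_ i) := yK; have /AdmP/(_ i) := zK; rewrite normal_comb.
    rewrite /slack sE normal_comb; move: (if i is inr _ then 1 else 0 : R) => b.
    move: (normal g i y) (normal g i z) => u w hw hu h.
    have /andP[t0 t1] := t01.
    have h' : t * (u - b) + (1 - t) * (w - b) = 0 by rewrite -[RHS]h; ring.
    have h1 : t * (u - b) >= 0 by rewrite mulr_ge0 // ltW.
    have h2 : (1 - t) * (w - b) >= 0 by rewrite mulr_ge0 // subr_ge0 ltW.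
    have /eqP : t * (u - b) = 0 by lra.
    rewrite mulf_eq0 (gt_eqF t0) subr_eq0 => /eqP ->.
    have /eqP : (1 - t) * (w - b) = 0 by lra.
    rewrite mulf_eq0 subr_eq0 (gt_eqF t1) subr_eq0 => /eqP ->.
    by rewrite mulNr subrr.
  have neg c : dot (dd c) x < 0 -> exists e, dd c e < 0.
    move=> lt; apply: contrapT => /forallNP h; move: lt; apply/negP; rewrite -leNgt.
    by apply: sumr_ge0 => e _; rewrite mulr_ge0 // leNgt; apply/negP/h.
  have dotN c : dot (dd (- c)) x = - dot (dd c) x by rewrite !dot_comb; ring.
  have ddN c e : dd (- c) e = - dd c e by rewrite !ffunE; ring.
  have [lt|gt|eq] := ltgtP (dot (dd 1) x) 0.
  - by exists (dd 1); split; [exact: ltW | exact: neg | exact: tight].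
  - have lt : dot (dd (-1)) x < 0 by rewrite dotN oppr_lt0.
    by exists (dd (-1)); split; [exact: ltW | exact: neg | exact: tight].
  have [e ne] : exists e, dd 1 e != 0.
    apply: contrapT => /forallNP h; apply: yz; apply/ffunP => e.
    have /negP := h e; rewrite negbK ffunE mul1r mulN1r subr_eq0 => /eqP //.
  have [lt|gt|/eqP] := ltgtP (dd 1 e) 0; last by rewrite (negPf ne).
    by exists (dd 1); split; [rewrite eq | exists e | exact: tight].
  exists (dd (-1)); split; [by rewrite dotN eq oppr0 | | exact: tight].
  by exists e; rewrite ddN oppr_lt0.
have /AdmP sl := sK.
(* The step length at which constraint [i] becomes tight; the least one over the decreasing
   constraints keeps the point admissible. *)
pose F i := slack g i s / - normal g i d.
have [i1 n1 F1] : exists2 i, normal g i d < 0 &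
    forall j, normal g j d < 0 -> F i <= F j.
  pose Q i := normal g i d < 0; have Qe : Q (inl e) := de.
  by case: (@arg_minP _ _ _ _ Q F Qe) => i; exists i.
pose s' := [ffun e => 1 * s e + F i1 * d e].
have sl' i : slack g i s' = slack g i s + F i1 * normal g i d.
  by rewrite /slack normal_comb mul1r addrAC.
have F0 : 0 <= F i1 by rewrite divr_ge0 // oppr_ge0 ltW.
have sK' : Adm (range g) s'.
  apply/AdmP => i; rewrite sl'; have [ge|lt] := leP 0 (normal g i d).
    by rewrite addr_ge0 // mulr_ge0.
  have := F1 _ lt; rewrite {2}/F ler_pdivlMr ?oppr_gt0 // mulrN; lra.
have [|s2 ext le] := IH s' _ sK'.
  rewrite ltnS in lem; apply: leq_trans lem; apply: proper_card; apply/properP; split.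
    apply/fintype.subsetP=> i; rewrite !inE sl'; apply: contra_neq => h.
    by rewrite h dtight // mulr0 addr0.
  exists i1; rewrite !inE.
    by apply: contraTneq n1 => /dtight ->; rewrite ltxx.
  rewrite negbK sl' /F invrN mulrN mulNr divfK ?subrr //.
  by rewrite lt_eqF.
exists s2 => //; apply: le_trans le _; rewrite dot_comb mul1r gerDl.
exact: mulr_ge0_le0.
Qed.

Lemma dot_blocker_ge1 n (g : 'I_n -> {ffun E -> R}) x s :
  Adm (Fulkerson_blocker (range g)) x -> Adm (range g) s -> 1 <= dot x s.
Proof.
move=> [x0 h] /(extreme_point_below x0)[s' ext]; rewrite (dotC x); apply: le_trans.
exact: h.
Qed.

(** Expanding the squared distance from [y] to [x] gives [energy2 x <= energy2 y], and equality
    makes this distance zero. *)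
Lemma optimal_densityP (G : set {ffun E -> R}) x : Adm G x ->
  (forall y, Adm G y -> energy2 x <= dot y x) -> optimal_density G x.
Proof.
move=> xG h; have dist y : energy2 [ffun e => 1 * y e + -1 * x e] =
    energy2 y - 2 * dot y x + energy2 x by rewrite energy2_comb; ring.
have le y : Adm G y -> energy2 x <= energy2 y.
  move=> /h; have := dist y; have := energy2_ge0 [ffun e => 1 * y e + -1 * x e].
  lra.
have ModE : Mod2 G = energy2 x.
  apply/le_anti/andP; split.
    by apply: ge_inf; [exists (energy2 x) => _ [y yG <-]; exact: le | exists x].
  by apply: lb_le_inf; [exists (energy2 x), x | move=> _ [y yG <-]; exact: le].
apply/seteqP; split=> y /=; last by move=> ->; rewrite ModE.
rewrite ModE => -[yG ey]; apply/ffunP=> e.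
have : energy2 [ffun e => 1 * y e + -1 * x e] = 0.
  have := dist y; have := h _ yG.
  have := energy2_ge0 [ffun e => 1 * y e + -1 * x e]; lra.
move=> /psumr_eq0P h0; have /eqP := h0 (fun i _ => sqr_ge0 _) e isT.
by rewrite sqrf_eq0 ffunE mul1r mulN1r subr_eq0 => /eqP.
Qed.

Lemma blocker_optimal_density n (g : 'I_n -> {ffun E -> R}) x :
  Adm (Fulkerson_blocker (range g)) x -> 0 < energy2 x ->
  (forall i, energy2 x <= dot x (g i)) ->
  optimal_density (Fulkerson_blocker (range g)) x.
Proof.
move=> xG x0 h; apply: optimal_densityP => // y yG.
(* This is [x] divided by its energy; the zero term only gives it the shape of [dot_comb]. *)
pose s := [ffun e => (energy2 x)^-1 * x e + 0 * x e].
have sG : Adm (range g) s.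
  split=> [e|_ [i _ <-]].
    by rewrite ffunE mul0r addr0 mulr_ge0 ?invr_ge0 ?(ltW x0) //; case: xG.
  rewrite -/(dot (g i) s) dotC dot_comb mul0r addr0 mulrC ler_pdivlMr // mul1r //.
have := dot_blocker_ge1 yG sG.
by rewrite dotC dot_comb mul0r addr0 mulrC ler_pdivlMr // mul1r dotC.
Qed.

(** Every extreme point of [Adm G] pairs to at least 1 with each member of [G], hence with their
    convex combinations. *)
Lemma combination_Adm_blocker (G : set {ffun E -> R}) n (p : 'I_n -> R) v :
  (forall i, 0 <= p i) -> \sum_i p i = 1 -> (forall i, G (v i)) ->
  (forall i e, 0 <= v i e) -> Adm (Fulkerson_blocker G) (combination p v).
Proof.
move=> p0 p1 vG v0; split=> [e|s [[_ sG] _]].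
  by rewrite ffunE; apply: sumr_ge0 => i _; rewrite mulr_ge0.
rewrite -/(dot s _) dotC dot_combination -p1; apply: ler_sum => i _.
by rewrite ler_peMr //; exact: sG.
Qed.

(* Abel summation over the level sets of [x]. *)
Lemma sum_sublevel (x d : E -> R) (M : R) : (forall e, x e <= M) ->
  (forall c, c < M -> \sum_(e | x e <= c) d e <= 0) ->
  \sum_e (M - x e) * d e <= 0.
Proof.
move=> xM; have [m] := ubnP #|[set e | x e != M]%SET|.
elim: m x xM => // m IH x xM lem h.
have [e0 /= ne0|allM] := pickP (fun e => x e != M); last first.
  rewrite big1 // => e _; have /negbT := allM e.
  by rewrite negbK => /eqP->; rewrite subrr mul0r.
have [e1 ne1 max1] : exists2 e1, x e1 != M & forall e, x e != M -> x e <= x e1.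
  by case: (@arg_maxP _ _ _ e0 (fun e => x e != M) x ne0) => e1; exists e1.
have lt1 : x e1 < M by rewrite lt_neqAle ne1 xM.
(* All values below [M] are shifted up so that the largest of them, [x e1], reaches [M]. Sublevel
   sets of [x'] below [M] are still sublevel sets of [x] below [M]. *)
pose x' e := if x e == M then M else x e + (M - x e1).
have -> : \sum_e (M - x e) * d e =
    \sum_e (M - x' e) * d e + (M - x e1) * \sum_(e | x e <= x e1) d e.
  rewrite mulr_sumr [X in _ = _ + X]big_mkcond -big_split /=.
  apply: eq_bigr => e _; rewrite /x'; case: eqP => [->|/eqP/max1->].
    by rewrite leNgt lt1 /=; ring.
  ring.
have x'M e : x' e <= M.
  by rewrite /x'; case: eqP => // /eqP/max1; lra.
have le1 : (M - x e1) * \sum_(e | x e <= x e1) d e <= 0.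
  by apply: mulr_ge0_le0; [rewrite subr_ge0 ltW | exact: h].
suff le2 : \sum_e (M - x' e) * d e <= 0 by lra.
apply: IH => // [|c cM].
  rewrite ltnS in lem; apply: leq_trans lem; apply: proper_card; apply/properP; split.
    apply/fintype.subsetP=> e; rewrite !inE /x'; have [_|//] := eqVneq (x e) M.
    by rewrite eqxx.
  by exists e1; rewrite !inE // negbK /x' (negPf ne1); apply/eqP; ring.
have lt : c - (M - x e1) < M by lra.
rewrite (eq_bigl (fun e => x e <= c - (M - x e1))) ?h // => e; rewrite /x'.
by case: eqP => [->|_]; [rewrite !leNgt cM lt | rewrite lerBrDr].
Qed.

End Blocker.

(** * Lightest hypertrees compared with multi-trees *)

Section LightestHypertrees.
Variables (R : realType) (H : hypergraph).
Implicit Types (F : {set edge H}) (A : edge_multiset H) (x : {ffun edge H -> R}).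

Definition indicator F : {ffun edge H -> R} := multiplicity_vector R (multiset_of F).

Definition sublevel x (c : R) : {set edge H} := [set e | x e <= c]%SET.

Definition lightest x F : Prop :=
  hypertree F /\ forall F', hypertree F' -> dot x (indicator F) <= dot x (indicator F').

Lemma indicatorE F e : indicator F e = (e \in F)%:R.
Proof. by rewrite !ffunE. Qed.

Lemma dot_indicator x F : dot x (indicator F) = \sum_(e in F) x e.
Proof.
rewrite [RHS]big_mkcond; apply: eq_bigr => e _; rewrite indicatorE.
by case: ifP; rewrite ?mulr1 ?mulr0.
Qed.

(** If some [e] of the sublevel could be added, exchange would trade a hyperedge of weight above [c]
    for [e], giving a lighter hypertree. *)
Lemma lightest_sublevel x F c : lightest x F ->
  maximal_hyperforest (sublevel x c) (F :&: sublevel x c).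
Proof.
move=> [tF minF]; apply/and3P; split; first exact: subsetIr.
  by case/andP: tF => hF _; exact: hyperforestS (subsetIl _ _) hF.
apply/forall_inP => e; rewrite inE => /andP[eF eU]; apply/negP => he.
have eF' : e \notin F by apply: contra eF => h; rewrite inE h.
have [f] := hypertree_exchange tF eU eF' he.
rewrite inE => /andP[fU fF] /minF; rewrite !dot_indicator.
rewrite (big_setD1 f fF) big_setU1 ?inE ?(negPf eF') ?andbF //=.
by rewrite lerD2r leNgt; move: eU fU; rewrite !inE -ltNge => h /(le_lt_trans h)->.
Qed.

Lemma lightest_leq_multitree x F A : lightest x F -> (forall e, x e <= 1) ->
  (forall e, x e < 1 -> exists2 F', lightest x F' & e \notin F') ->
  is_hypertree [set: vertex H]%SET A ->
  dot x (indicator F) <= dot x (multiplicity_vector R A).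
Proof.
move=> lF x1 avoid [hA sA].
(* Both sides have [#|V| - 1] hyperedges, so [d] has sum zero and weights [x] may be replaced by
   [1 - x], as Abel summation requires. *)
pose d e : R := (A e)%:R - (e \in F)%:R.
have sumd : \sum_e d e = 0.
  have [/is_hypertreeP[_ sF] _] := lF.
  rewrite sumrB -!natr_sum sA -sF; apply/eqP; rewrite subr_eq0 eqr_nat.
  by apply/eqP/eq_bigr => e _; rewrite ffunE.
have level c : c < 1 -> \sum_(e | x e <= c) d e <= 0.
  move=> c1; rewrite sumrB -!natr_sum subr_le0 ler_nat.
  have maxF := lightest_sublevel c lF.
  have -> : (\sum_(e | (x e <= c)%R) (e \in F) = #|F :&: sublevel x c|)%N.
    rewrite -sum_multiset_of; apply: eq_big => e; first by rewrite inE.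
    by rewrite ffunE.
  rewrite (eq_bigl (mem (sublevel x c))); last by move=> e; rewrite /= inE.
  apply: (multiforest_leq_maximal maxF) => // e; rewrite inE => xe.
  have [F' lF' eF'] := avoid e (le_lt_trans xe c1).
  exists (F' :&: sublevel x c); first exact: lightest_sublevel.
  by rewrite inE (negPf eF').
rewrite -subr_ge0 -sumrB.
have := sum_sublevel x1 level.
have -> : \sum_e (1 - x e) * d e = \sum_e d e - \sum_e x e * d e.
  by rewrite -sumrB; apply: eq_bigr => e _; ring.
rewrite sumd sub0r oppr_le0 => /le_trans; apply; apply: ler_sum => e _.
by rewrite !ffunE /d mulrBr.
Qed.

End LightestHypertrees.

(** * Finite enumerations and conclusion *)

Lemma range_enum (I : finType) (P : set I) : exists n (h : 'I_n -> I), range h = P.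
Proof.
exists #|[set i | `[< P i >]]%SET|, enum_val; apply/seteqP; split=> [_ [k _ <-]|i Pi].
  by have := enum_valP k; rewrite inE => /asboolP.
have iP : i \in [set i | `[< P i >]]%SET by rewrite inE; apply/asboolP.
by exists (enum_rank_in iP i) => //; rewrite enum_rankK_in.
Qed.

(** A multi-tree has [#|V| - 1] hyperedges in all, so its multiplicities are below [#|V|] and range
    over a finite type. *)
Lemma multitree_family_enum (R : realType) (H : hypergraph) :
  exists n (g : 'I_n -> {ffun edge H -> R}), @multitree_family R H = range g.
Proof.
pose val (a : {ffun edge H -> 'I_#|vertex H|}) : edge_multiset H := [ffun e => a e : nat].
pose tree A := covered A = [set: vertex H]%SET /\ is_hypertree (covered A) A.
have [n [h hE]] := range_enum [set a | tree (val a)].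
exists n, (@multiplicity_vector R H \o val \o h).
transitivity ((@multiplicity_vector R H \o val) @` range h); last by rewrite image_comp.
rewrite hE; apply/seteqP; split=> [_ [A tA <-]|_ [a ta <-]]; last by exists (val a).
have [cov [_ sA]] := tA.
have lt e : (A e < #|vertex H|)%N.
  have : (A e <= \sum_e' A e')%N by rewrite (bigD1 e) //= leq_addr.
  by rewrite sA cov cardsT; have := vertex_gt0 H; lia.
have AE : val [ffun e => Ordinal (lt e)] = A by apply/ffunP=> e; rewrite !ffunE.
by exists [ffun e => Ordinal (lt e)]; rewrite /= AE.
Qed.

Theorem theorem1p10 (R : realType) (H : hypergraph) :
  (2 <= #|vertex H|)%N -> hypergraph_connected H -> partition_connected H ->
  exists rho : {ffun edge H -> R},
    optimal_density (Fulkerson_blocker (@multitree_family R H)) rho /\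
    optimal_density (Fulkerson_blocker (@hypertree_family R H)) rho.
Proof.
move=> V2 _ pc.
have [n [h hE]] := range_enum [set F : {set edge H} | hypertree F].
have tree_h i : hypertree (h i) by have : range h (h i); [exists i | rewrite hE].
have onto_h F : hypertree F -> exists i, h i = F.
  by move=> tF; have : range h F; [rewrite hE | move=> [i _ <-]; exists i].
pose v i := indicator R (h i).
have treeE : @hypertree_family R H = range v.
  have -> : range v = (@indicator R H) @` range h by rewrite image_comp.
  by rewrite hE; apply/seteqP; split=> _ [F /is_hypertreeP tF <-]; exists F.
have n0 : (0 < n)%N.
  by have [F /onto_h[i _]] := hypertree_exists pc; apply: leq_ltn_trans (ltn_ord i).
have [p [p0 p1 pmin]] := min_norm_combination v n0.
have psup := min_norm_support p0 p1 pmin; set x := combination p v in pmin psup.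
have xE e : x e = \sum_i p i * (e \in h i)%:R.
  by rewrite ffunE; apply: eq_bigr => i _; rewrite indicatorE.
have x1 e : x e <= 1.
  by rewrite xE -[leRHS]p1; apply: ler_sum => i _; rewrite ler_piMr // lern1 leq_b1.
have light i : 0 < p i -> lightest x (h i).
  by move=> pi; split=> // F /onto_h[j <-]; rewrite -/(v i) -/(v j) psup.
(* [x e] is the weighted share of hypertrees containing [e]; were [e] in all those of positive
   weight, it would be 1. *)
have avoid e : x e < 1 -> exists2 F, lightest x F & e \notin F.
  move=> xe; apply: contrapT => /forall2NP nF; move: xe; rewrite xE -[ltRHS]p1.
  rewrite (eq_bigr p) ?ltxx // => i _.
  have [pi|] := ltP 0 (p i); last first.
    by move=> pi; have -> : p i = 0; [apply/le_anti; rewrite pi p0 | rewrite mul0r].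
  by case: (nF (h i)) => [/(_ (light i pi))//|/negP]; rewrite negbK => ->; rewrite mulr1.
have [i pi] : exists i, 0 < p i.
  apply: contrapT => /forallNP np; have /eqP := p1; rewrite big1 => [|i _].
    by rewrite eq_sym oner_eq0.
  by apply/le_anti; rewrite p0 andbT leNgt; apply/negP/np.
have x_gt0 : 0 < energy2 x.
  have /card_gt0P[e ei] : (0 < #|h i|)%N.
    by have /andP[_ /eqP cF] := tree_h i; move: V2; rewrite -cF ltnS.
  have xe : 0 < x e.
    rewrite xE (bigD1 i) //= ei mulr1 ltr_pwDl //.
    by apply: sumr_ge0 => j _; rewrite mulr_ge0.
  rewrite /energy2 (bigD1 e) //= ltr_pwDl ?exprn_gt0 //.
  by apply: sumr_ge0 => j _; rewrite sqr_ge0.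
(* Hypertrees are multi-trees, so the same [x] is admissible for both blockers. *)
have v_multitree j : @multitree_family R H (v j).
  exists (multiset_of (h j)) => //=; rewrite hypertree_covered //; split=> //.
  exact/is_hypertreeP.
have v0 j e : 0 <= v j e by rewrite indicatorE.
have [m [g multiE]] := multitree_family_enum R H.
exists x; split.
  rewrite multiE; apply: blocker_optimal_density => // [|k].
    by rewrite -multiE; exact: combination_Adm_blocker.
  have [A [cov tA] <-] : @multitree_family R H (g k) by rewrite multiE; exists k.
  rewrite -(psup i pi); apply: lightest_leq_multitree => //; first exact: light.
  by rewrite -cov.
rewrite treeE; apply: blocker_optimal_density => //.
by apply: combination_Adm_blocker => // j; exists j.
Qed.
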